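(* Let $k\in(0,1)$ and let $f\in\Sigma_{\mathrm{H}}(k)$ be of the form $$f(z)=\alpha z+\beta\overline{z}+\sum_{n=0}^{\infty}a_nz^{-n}+\overline{\sum_{n=1}^\infty b_nz^{-n}}+A\log|z|,\quad z\in\Delta.$$ Then $f$ has a homeomorphic extension to the unit circle (again denoted by $f$). Moreover, the mapping $$F(z)=\begin{cases} f(z), & |z|\ge1,\\ \alpha z+\beta\overline{z}+\sum_{n=0}^{\infty}a_n\overline{z}^{\,n}+\sum_{n=1}^\infty\overline{b_n}\,z^{n}, & |z|\le1,\end{cases}$$ is a quasiconformal extension of $f$ with $|\mu_F(z)|\le k$ for $z\in\mathbb{C}$.
   Context: $\Delta=\{z\in\mathbb{C}:|z|>1\}$. $\Sigma_{\mathrm{H}}$ is the class of harmonic sense-preserving univalent (one-to-one) functions in $\Delta$ that map $\infty$ to $\infty$; each $f\in\Sigma_{\mathrm{H}}$ has a representation $$f(z)=\alpha z+\beta\overline{z}+\sum_{n=0}^{\infty}a_nz^{-n}+\overline{\sum_{n=1}^\infty b_nz^{-n}}+A\log|z|,\quad z\in\Delta,$$ where $0\le|\beta|<|\alpha|$ and $A\in\mathbb{C}$. For $0<k<1$, $\Sigma_{\mathrm{H}}(k)$ is the subclass of $f\in\Sigma_{\mathrm{H}}$ satisfying $$|\beta|+|A|+\sum_{n=1}^\infty n(|a_n|+|b_n|)\le k|\alpha|.$$ The complex dilatation is $\mu_F=F_{\bar z}/F_z$, defined almost everywhere, and bounds on it over $\mathbb{C}$ are understood almost everywhere. A sense-preserving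 (quasiconformal) homeomorphism $F$ is $k$-quasiconformal if $|\mu_F|\le k<1$ almost everywhere; it is quasiconformal if this holds for some $k<1$. *)

(* Defs.v *)
From HB Require Import structures.
From mathcomp Require Import all_boot all_order all_algebra.
From mathcomp Require Import complex.
From mathcomp Require Import all_classical all_reals all_analysis.

Set Implicit Arguments.
Unset Strict Implicit.
Unset Printing Implicit Defensive.

Import Order.TTheory GRing.Theory Num.Theory.
Import numFieldNormedType.Exports.
Import Normc.

Local Open Scope classical_set_scope.
Local Open Scope ring_scope.
Local Open Scope complex_scope.

Section ComplexPlane.
Context {R : realType}.

(* The topology of the plane is the one carried by [R[i]^o], i.e. [R[i]] as a
   normed module over itself; [normc] is the real-valued modulus. *)
Local Notation C := (R[i]).

Definition Delta : set C := [set z | 1 < normc z].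
Definition closed_Delta : set C := [set z | 1 <= normc z].
Definition closed_disk : set C := [set z | normc z <= 1].

Definition expi (t : R) : C := cos t +i* sin t.

(* Series [u m + u m.+1 + ...]; [csum] is only meaningful under [csummable]. *)
Definition cpartial (m : nat) (u : nat -> C) : nat -> C^o :=
  fun N => \sum_(m <= n < N) u n.
Definition csummable (m : nat) (u : nat -> C) : Prop := cvgn (cpartial m u).
Definition csum (m : nat) (u : nat -> C) : C := limn (cpartial m u).

(* Partial derivatives with respect to x and y, where z = x + i y. *)
Definition has_partials (F : C -> C) (z : C) : Prop :=
  [/\ derivable (fun t : R => complex.Re (F (z + t%:C))) 0 1,
      derivable (fun t : R => complex.Im (F (z + t%:C))) 0 1,
      derivable (fun t : R => complex.Re (F (z + t *i))) 0 1
    & derivable (fun t : R => complex.Im (F (z + t *i))) 0 1].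

Definition dx (F : C -> C) (z : C) : C :=
  derive1 (fun t : R => complex.Re (F (z + t%:C))) 0 +i*
  derive1 (fun t : R => complex.Im (F (z + t%:C))) 0.

Definition dy (F : C -> C) (z : C) : C :=
  derive1 (fun t : R => complex.Re (F (z + t *i))) 0 +i*
  derive1 (fun t : R => complex.Im (F (z + t *i))) 0.

Definition dz (F : C -> C) (z : C) : C := (dx F z - 'i%C * dy F z) / 2%:R.
Definition dzbar (F : C -> C) (z : C) : C := (dx F z + 'i%C * dy F z) / 2%:R.

Definition dilatation (F : C -> C) (z : C) : C := dzbar F z / dz F z.

Definition continuous_on_open (U : set C) (F : C -> C) : Prop :=
  forall z, U z -> {for z, continuous (F : C^o -> C^o)}.

(* [U] is meant to be open: [F] is C^2 in [U] with vanishing Laplacian. *)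
Definition harmonic_on (U : set C) (F : C -> C) : Prop :=
  [/\ forall z, U z ->
        [/\ has_partials F z, has_partials (dx F) z & has_partials (dy F) z],
      [/\ continuous_on_open U (dx (dx F)), continuous_on_open U (dx (dy F)),
          continuous_on_open U (dy (dx F)) & continuous_on_open U (dy (dy F))]
    & forall z, U z -> dx (dx F) z + dy (dy F) z = 0].

(* Topological notion for a continuous injective map on an open set: the image
   of every positively oriented circle bounding a disk in [U] winds exactly
   once, positively, around the image of the center; [theta] is a continuous
   choice of argument along the image curve. *)
Definition sense_preserving_on (U : set C) (F : C -> C) : Prop :=
  forall (p : C) (r : R), 0 < r -> [set z | normc (z - p) <= r] `<=` U ->
    exists theta : R -> R,
      [/\ continuous theta,
          forall t, F (p + r%:C * expi t) - F p =
            (normc (F (p + r%:C * expi t) - F p))%:C * expi (theta t)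
        & theta (2 * pi) = theta 0 + 2 * pi].

Definition maps_infty_to_infty (f : C -> C) : Prop :=
  forall M : R, exists r : R, forall z, r < normc z -> M < normc (f z).

(* Only the values of [f] on [Delta] matter. *)
Definition SigmaH (f : C -> C) : Prop :=
  [/\ harmonic_on Delta f, sense_preserving_on Delta f,
      {in Delta &, injective f} & maps_infty_to_infty f].

(* The representation of [f]; the value [b 0] plays no role. *)
Definition has_expansion (f : C -> C) (alpha beta : C) (a b : nat -> C) (A : C)
    : Prop :=
  normc beta < normc alpha /\
  forall z, Delta z ->
    [/\ csummable 0 (fun n => a n * z ^- n),
        csummable 1 (fun n => b n * z ^- n)
      & f z = alpha * z + beta * conjc z + csum 0 (fun n => a n * z ^- n)
              + conjc (csum 1 (fun n => b n * z ^- n)) + A * (ln (normc z))%:C].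

Definition SigmaH_of (k : R) (f : C -> C) (alpha beta : C) (a b : nat -> C)
    (A : C) : Prop :=
  [/\ SigmaH f, has_expansion f alpha beta a b A
    & ((normc beta + normc A)%:E +
       \sum_(1 <= n <oo) (n%:R * (normc (a n) + normc (b n)))%:E
       <= (k * normc alpha)%:E)%E].

Definition homeomorphism_onto_image (E : set C) (f : C -> C) : Prop :=
  {within (E : set C^o), continuous (f : C^o -> C^o)} /\
  exists g : C -> C, {within (f @` E : set C^o), continuous (g : C^o -> C^o)} /\
    forall z, E z -> g (f z) = z.

Definition plane_homeomorphism (F : C -> C) : Prop :=
  continuous (F : C^o -> C^o) /\
  exists G : C -> C,
    [/\ continuous (G : C^o -> C^o), cancel F G & cancel G F].

Definition absolutely_continuous_on (a b : R) (g : R -> C) : Prop :=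
  forall e : R, 0 < e -> exists2 d : R, 0 < d &
    forall (n : nat) (l r : 'I_n -> R),
      (forall i, a <= l i /\ l i <= r i /\ r i <= b) ->
      (forall i j, i != j -> r i <= l j \/ r j <= l i) ->
      \sum_(i < n) (r i - l i) < d ->
      \sum_(i < n) normc (g (r i) - g (l i)) < e.

(* Absolute continuity on lines. *)
Definition ACL (F : C -> C) : Prop :=
  forall a b c d : R, a <= b -> c <= d ->
    {ae lebesgue_measure, forall y : R, c <= y <= d ->
       absolutely_continuous_on a b (fun x => F (x +i* y))} /\
    {ae lebesgue_measure, forall x : R, a <= x <= b ->
       absolutely_continuous_on c d (fun y => F (x +i* y))}.

Definition ae_plane (P : C -> Prop) : Prop :=
  {ae (@lebesgue_measure R \x @lebesgue_measure R)%E,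
     forall p : R * R, P (p.1 +i* p.2)}.

(* Nonvanishing of [dz F] is required because [dilatation] would otherwise
   take the conventional value 0. *)
Definition dilatation_bounded (k : R) (F : C -> C) : Prop :=
  ae_plane (fun z =>
    [/\ has_partials F z, dz F z != 0 & normc (dilatation F z) <= k]).

(* Analytic definition, for maps of the plane onto itself. *)
Definition k_quasiconformal (k : R) (F : C -> C) : Prop :=
  [/\ plane_homeomorphism F, sense_preserving_on setT F, ACL F
    & dilatation_bounded k F].

Definition quasiconformal (F : C -> C) : Prop :=
  exists2 k : R, 0 <= k < 1 & k_quasiconformal k F.

Definition disk_map (alpha beta : C) (a b : nat -> C) (z : C) : C :=
  alpha * z + beta * conjc z + csum 0 (fun n => a n * conjc z ^+ n)
  + csum 1 (fun n => conjc (b n) * z ^+ n).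

End ComplexPlane.

(* Main.v *)
Require Import Defs.
From HB Require Import structures.
From mathcomp Require Import all_boot all_order all_algebra.
From mathcomp Require Import complex.
From mathcomp Require Import all_classical all_reals all_analysis.
From mathcomp Require Import measurable_realfun.
From mathcomp Require Import ring lra.

Set Implicit Arguments.
Unset Strict Implicit.
Unset Printing Implicit Defensive.

Import Order.TTheory GRing.Theory Num.Theory.
Import numFieldNormedType.Exports.
Import Normc.

Local Open Scope classical_set_scope.
Local Open Scope ring_scope.
Local Open Scope complex_scope.

(* Let [phi z = conj z] in the closed disk and [1/z] outside: a 1-Lipschitz map
   of the plane into the closed disk. Both formulas for [F] become
     F = alpha z + h,  h = beta (conj z) + sum a_n phi^n + conj (sum b_n phi^n)
                           + A log (max 1 |z|),
   and since [phi^n] is n-Lipschitz and the logarithm is 1-Lipschitz, the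
   coefficient condition says that [h] is (k |alpha|)-Lipschitz. So [F] is a
   Lipschitz perturbation of a similarity: it is a bi-Lipschitz homeomorphism by
   the contraction principle, absolutely continuous on all lines, and it winds
   around circles as [alpha z] does. Off the unit circle [h] is real
   differentiable, and the Lipschitz bound reads |h_z| + |h_zbar| <= k |alpha|,
   whence |F_zbar| <= k |alpha| - |h_z| <= k |F_z|. *)

(** * Elementary estimates for the modulus *)

Section Modulus.
Context {R : realType}.
Local Notation C := (R[i]).
Implicit Types x y z : C.

Lemma normc_ge0 x : 0 <= normc x.
Proof. by case: x => a b; exact: sqrtr_ge0. Qed.

Lemma normc_sqr x : normc x ^+ 2 = complex.Re x ^+ 2 + complex.Im x ^+ 2.
Proof. by case: x => a b /=; rewrite sqr_sqrtr// addr_ge0 ?sqr_ge0. Qed.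

Lemma normC_normc x : `|x| = (normc x)%:C.
Proof. by case: x. Qed.

Lemma normc_eq0 x : (normc x == 0) = (x == 0).
Proof.
by apply/eqP/eqP => [/eq0_normc//|->]; rewrite normc0.
Qed.

Lemma normc_gt0 x : (0 < normc x) = (x != 0).
Proof. by rewrite lt_def normc_ge0 andbT normc_eq0. Qed.

Lemma normcN x : normc (- x) = normc x.
Proof. by case: x => a b /=; rewrite !sqrrN. Qed.

Lemma normc_dist x y : normc (x - y) = normc (y - x).
Proof. by rewrite -normcN opprB. Qed.

Lemma normc_conj x : normc (conjc x) = normc x.
Proof. by case: x => a b /=; rewrite sqrrN. Qed.

Lemma normc_real (r : R) : normc r%:C = `|r|.
Proof. by rewrite /= expr0n/= addr0 sqrtr_sqr. Qed.

Lemma normcX x n : normc (x ^+ n) = normc x ^+ n.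
Proof.
by elim: n => [|n IH]; rewrite ?expr0 ?normc1// !exprS normcM IH.
Qed.

Lemma normc_le_add x y z (a b : R) :
  normc (x - y) <= a -> normc (y - z) <= b -> normc (x - z) <= a + b.
Proof.
move=> xa yb; have -> : x - z = (x - y) + (y - z) by ring.
by rewrite (le_trans (le_normcD _ _))// lerD.
Qed.

Lemma normc_geB x y : normc x - normc y <= normc (x - y).
Proof. by rewrite lerBlDr -{1}(subrK y x) le_normcD. Qed.

Lemma Re_le_normc x : `|complex.Re x| <= normc x.
Proof.
rewrite -(ler_pXn2r (_ : 0 < 2)%N) ?nnegrE ?normc_ge0// normc_sqr real_normK ?num_real//.
by rewrite lerDl sqr_ge0.
Qed.

Lemma Im_le_normc x : `|complex.Im x| <= normc x.
Proof.
rewrite -(ler_pXn2r (_ : 0 < 2)%N) ?nnegrE ?normc_ge0// normc_sqr real_normK ?num_real//.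
by rewrite lerDr sqr_ge0.
Qed.

Lemma normc_le_ReIm x : normc x <= `|complex.Re x| + `|complex.Im x|.
Proof.
rewrite -(ler_pXn2r (_ : 0 < 2)%N) ?nnegrE ?normc_ge0 ?addr_ge0// normc_sqr.
rewrite sqrrD !real_normK ?num_real// -addrA lerD2l lerDr mulrn_wge0//.
Qed.

Lemma normc_sum (I : Type) (r : seq I) (P : pred I) (E : I -> C) :
  normc (\sum_(i <- r | P i) E i) <= \sum_(i <- r | P i) normc (E i).
Proof.
elim/big_rec2: _ => [|i a b _ ba]; first by rewrite normc0.
by rewrite (le_trans (le_normcD _ _))// lerD.
Qed.

End Modulus.

(** * Limits of complex sequences and Lipschitz maps *)

Section Limits.
Context {R : realType}.
Local Notation C := (R[i]).

(** In the order of [R[i]] a positive tolerance has zero imaginary part, so complex epsilons can be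
    traded for real ones and convergence is moved into [R]. *)
Lemma cvg_normcP (x : nat -> C) (l : C) :
  ((x : nat -> C^o) @ \oo --> (l : C^o)) <->
  (normc (x n - l) @[n --> \oo] --> (0 : R)).
Proof.
split=> [/cvgrPdist_lt xl|/cvgrPdist_lt xl].
  apply/cvgrPdist_lt => e e0; have := xl e%:C; rewrite ltcR => /(_ e0).
  apply: filterS => n; rewrite normC_normc ltcR sub0r normrN ger0_norm ?normc_ge0//.
  by rewrite normc_dist.
apply/cvgrPdist_lt => e; rewrite ltcE => /andP[/eqP /= e0 e1].
have := xl _ e1; apply: filterS => n.
rewrite sub0r normrN ger0_norm ?normc_ge0// => ne.
rewrite normC_normc normc_dist ltcE/= e0 eqxx/=; exact: ne.
Qed.

Lemma le_of_cvg0 (a b : R) (s : nat -> R) :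
  s @ \oo --> (0 : R) -> (forall n, a <= b + s n) -> a <= b.
Proof.
move=> s0 abs; apply/ler_addgt0Pr => e e0.
have /cvgrPdist_lt/(_ _ e0)[N _ /(_ N (leqnn N))] := s0.
rewrite sub0r normrN => sN; rewrite (le_trans (abs N))// lerD2l.
by rewrite (le_trans (ler_norm _))// ltW.
Qed.

Lemma normc_cvg_pair (x : nat -> C) (l : C) :
  (fun n => complex.Re (x n)) @ \oo --> complex.Re l ->
  (fun n => complex.Im (x n)) @ \oo --> complex.Im l ->
  normc (x n - l) @[n --> \oo] --> (0 : R).
Proof.
move=> /cvgr_dist_lt rl /cvgr_dist_lt il.
apply/cvgrPdist_lt => e e0; have e2 : 0 < e / 2 by rewrite divr_gt0.
near=> n; rewrite sub0r normrN ger0_norm ?normc_ge0//.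
rewrite (le_lt_trans (normc_le_ReIm _))// [ltRHS](splitr e) !raddfB/= ltrD//.
  by rewrite distrC; near: n; exact: rl.
by rewrite distrC; near: n; exact: il.
Unshelve. all: by end_near. Qed.

(** Real and imaginary parts are Cauchy sequences in [R]. The rate [e n] survives because the term
    in [m] vanishes as [m] tends to infinity. *)
Lemma cvg_normc_cauchy (x : nat -> C) (e : nat -> R) :
  e @ \oo --> (0 : R) ->
  (forall n m, normc (x n - x m) <= e n + e m) ->
  exists l : C, normc (x n - l) @[n --> \oo] --> (0 : R) /\
    forall n, normc (x n - l) <= e n.
Proof.
move=> e0 xe.
have cvgp (p : C -> R) : (forall u v, `|p u - p v| <= normc (u - v)) ->
    cvgn (fun n => p (x n)).
  move=> pl; apply/cauchy_cvgP/cauchy_exP => d d0.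
  have d2 : 0 < d / 2 by rewrite divr_gt0.
  have /cvgrPdist_lt/(_ _ d2)[N _ HN] := e0.
  have eN n : (N <= n)%N -> e n < d / 2.
    by move=> /HN; rewrite /= sub0r normrN; apply: le_lt_trans; exact: ler_norm.
  exists (p (x N)); exists N => // n /= Nn.
  rewrite /ball/= (le_lt_trans (pl _ _))// (le_lt_trans (xe _ _))//.
  by rewrite [ltRHS]splitr ltrD// eN.
have /cvg_ex[r xr] : cvgn (fun n => complex.Re (x n)).
  by apply: cvgp => u v; rewrite -raddfB Re_le_normc.
have /cvg_ex[i xi] : cvgn (fun n => complex.Im (x n)).
  by apply: cvgp => u v; rewrite -raddfB Im_le_normc.
have xl := @normc_cvg_pair x (r +i* i) xr xi.
exists (r +i* i); split => // n.
apply: (@le_of_cvg0 _ _ (fun m => e m + normc (x m - (r +i* i)))).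
  by rewrite -[X in _ --> X]addr0; apply: cvgD.
by move=> m; rewrite addrA; exact: normc_le_add (xe _ _) (lexx _).
Qed.

Definition lipc (L : R) (g : C -> C) : Prop :=
  forall u v, normc (g u - g v) <= L * normc (u - v).

Lemma lipc_continuous L (g : C -> C) : lipc L g -> continuous (g : C^o -> C^o).
Proof.
move=> gL z.
apply/(@cvgrPdist_lt _ C^o C^o (nbhs (z : C^o)) (nbhs_filter (z : C^o))) => e.
rewrite ltcE => /andP[/eqP /= e0 e1].
have L0 : 0 < `|L| + 1 by rewrite ltr_wpDl.
have d0 : 0 < complex.Re e / (`|L| + 1) by rewrite divr_gt0.
apply/(@nbhs_ballP _ C^o); exists (complex.Re e / (`|L| + 1))%:C; rewrite /= ?ltcR// => w.
rewrite -ball_normE /=.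
rewrite !normC_normc ltcR ltcE /= e0 eqxx /= => zw.
rewrite (le_lt_trans (gL _ _))// (@le_lt_trans _ _ ((`|L| + 1) * normc (z - w)))//.
  by rewrite ler_wpM2r ?normc_ge0// (le_trans (ler_norm _))// lerDl.
by rewrite mulrC -ltr_pdivlMr.
Qed.

(** Banach's fixed point argument, with Picard iterates started at 0. *)
Lemma lipc_iter_fixpoint (k : R) (g : C -> C) : 0 <= k < 1 -> lipc k g ->
  exists z, g z = z.
Proof.
move=> /andP[k0 k1] gk.
pose x n := iter n g 0; pose D := normc (x 1%N - x 0%N) / (1 - k).
have k1' : 0 < 1 - k by rewrite subr_gt0.
have D0 : 0 <= D by rewrite divr_ge0 ?normc_ge0// ltW.
(* Writing the geometric bound as a difference makes the sum of the steps telescope; [D] is the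
   total length of the geometric series. *)
have step n : normc (x n.+1 - x n) <= D * k ^+ n - D * k ^+ n.+1.
  have -> : D * k ^+ n - D * k ^+ n.+1 = normc (x 1%N - x 0%N) * k ^+ n.
    by rewrite exprS /D; field; rewrite gt_eqF.
  elim: n => [|n IH]; first by rewrite expr0 mulr1.
  rewrite (le_trans (gk _ _))// exprS mulrCA ler_wpM2l//.
have dist n m : normc (x (n + m)%N - x n) <= D * k ^+ n.
  suff : normc (x (n + m)%N - x n) <= D * k ^+ n - D * k ^+ (n + m).
    by move/le_trans; apply; rewrite gerBl mulr_ge0// exprn_ge0.
  elim: m => [|m IH]; first by rewrite addn0 !subrr normc0.
  rewrite addnS; apply: le_trans (normc_le_add (step _) IH) _.
  by rewrite addrC addrA addrNK.
have [|n m|l [_ xl]] := @cvg_normc_cauchy x (fun n => D * k ^+ n).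
- rewrite -(mulr0 D); apply: cvgM; first exact: cvg_cst.
  have := @cvg_geometric R 1 k; rewrite ger0_norm// => /(_ k1).
  by apply: cvg_trans; apply: near_eq_cvg; near=> n; rewrite /geometric/= mul1r.
- have Dk i : 0 <= D * k ^+ i by rewrite mulr_ge0// exprn_ge0.
  case: (leqP n m) => nm.
    by rewrite normc_dist -(subnKC nm) (le_trans (dist _ _))// lerDl.
  by rewrite -(subnKC (ltnW nm)) (le_trans (dist _ _))// lerDr.
exists l; apply/eqP; rewrite -subr_eq0 -normc_eq0 eq_le normc_ge0 andbT.
(* [g l] is compared with [l] through [x n.+1]; each of the two errors is at most
   [D * k ^+ n.+1]. *)
apply: (@le_of_cvg0 _ _ (fun n => 2 * D * k * k ^+ n)).
  rewrite -(mulr0 (2 * D * k)); apply: cvgM; first exact: cvg_cst.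
  have := @cvg_geometric R 1 k; rewrite ger0_norm// => /(_ k1).
  by apply: cvg_trans; apply: near_eq_cvg; near=> n; rewrite /geometric/= mul1r.
move=> n; rewrite add0r.
have h1 : normc (g l - x n.+1) <= k * (D * k ^+ n).
  by rewrite (le_trans (gk _ _))// ler_wpM2l// normc_dist.
apply: (le_trans (normc_le_add h1 (xl _))); rewrite exprS le_eqVlt.
by apply/orP; left; apply/eqP; ring.
Unshelve. all: by end_near. Qed.

End Limits.

(** * Lipschitz constants of the reflection, its powers and the truncated logarithm *)

Section Lipschitz.
Context {R : realType}.
Local Notation C := (R[i]).
Implicit Types (f g : C -> C) (u v z w : C).

Lemma lipc_add L M f g : lipc L f -> lipc M g -> lipc (L + M) (fun z => f z + g z).
Proof.
move=> fL gM u v; rewrite opprD addrACA mulrDl.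
by rewrite (le_trans (le_normcD _ _))// lerD.
Qed.

Lemma lipc_scale L c f : lipc L f -> lipc (normc c * L) (fun z => c * f z).
Proof.
by move=> fL u v; rewrite -mulrBr normcM -mulrA ler_wpM2l ?normc_ge0.
Qed.

Lemma lipc_conj L f : lipc L f -> lipc L (fun z => conjc (f z)).
Proof. by move=> fL u v; rewrite -rmorphB/= normc_conj. Qed.

Lemma lipc_id : lipc 1 (fun z : C => z).
Proof. by move=> u v; rewrite mul1r. Qed.

Lemma lipc_sum (L : nat -> R) (f : nat -> C -> C) m n :
  (forall i, lipc (L i) (f i)) ->
  lipc (\sum_(m <= i < n) L i) (fun z => \sum_(m <= i < n) f i z).
Proof.
move=> fL u v; rewrite -sumrB mulr_suml (le_trans (normc_sum _ _ _))//.
by apply: ler_sum => i _; exact: fL.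
Qed.

Lemma lipc_le L M f : L <= M -> lipc L f -> lipc M f.
Proof. by move=> LM fL u v; rewrite (le_trans (fL u v))// ler_wpM2r ?normc_ge0. Qed.

(* The map [phi] of the header: [conjc z] in the closed disk, [z^-1] outside. *)
Definition unit_fold z : C := conjc z / ((Num.max 1 (normc z)) ^+ 2)%:C.

Lemma fold_disk z : normc z <= 1 -> unit_fold z = conjc z.
Proof. by move=> z1; rewrite /unit_fold max_l// expr1n divr1. Qed.

Lemma mulc_conj z : z * conjc z = (normc z ^+ 2)%:C.
Proof.
rewrite normc_sqr; case: z => a b; apply/eqP; rewrite eq_complex /=.
by apply/andP; split; apply/eqP; ring.
Qed.

Lemma normc_inv_conj z : z != 0 -> z^-1 = conjc z / (normc z ^+ 2)%:C.
Proof.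
move=> z0; apply: (mulfI z0); rewrite divff// mulrA mulc_conj divff//.
by rewrite fmorph_eq0 expf_eq0/= normc_eq0.
Qed.

Lemma fold_outside z : 1 <= normc z -> unit_fold z = z^-1.
Proof.
move=> z1; rewrite /unit_fold max_r// normc_inv_conj// -normc_gt0.
exact: lt_le_trans z1.
Qed.

Lemma normc_fold z : normc (unit_fold z) <= 1.
Proof.
have [z1|z1] := leP (normc z) 1; first by rewrite fold_disk// normc_conj.
by rewrite (fold_outside (ltW z1)) normcV invf_le1 ?ltW// (lt_trans _ z1).
Qed.

(** With [s = |w|^2] and [c = Re (z * conjc w)], the squared distances are [|z|^2 + 1/s - 2c/s] and
    [|z|^2 + s - 2c]. They differ by [(s - 1) (s + 1 - 2c) / s], which is nonnegative because
    [2c <= |z|^2 + |w|^2 <= 1 + s]. *)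
Lemma lipc_fold_mixed z w : normc z <= 1 -> 1 <= normc w ->
  normc (unit_fold z - unit_fold w) <= normc (z - w).
Proof.
move=> z1 w1; have w0 : 0 < normc w by exact: lt_le_trans w1.
rewrite fold_disk// fold_outside// normc_inv_conj -?normc_gt0//.
rewrite -(ler_pXn2r (_ : 0 < 2)%N) ?nnegrE ?normc_ge0//.
have zz := normc_sqr z; have ww := normc_sqr w.
set s := normc w ^+ 2 in ww *; have s1 : 1 <= s by rewrite /s exprn_ege1.
have s0 : s != 0 by rewrite gt_eqF// (lt_le_trans _ s1).
set c := complex.Re z * complex.Re w + complex.Im z * complex.Im w.
have cs : 2 * c <= s + 1.
  have : 0 <= normc (z - w) ^+ 2 by rewrite exprn_ge0// normc_ge0.
  have z2 : normc z ^+ 2 <= 1 by rewrite exprn_ile1// normc_ge0.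
  rewrite normc_sqr !raddfB/= => h; move: z2; rewrite zz ww /c => z2; nra.
rewrite [leLHS](_ : _ = normc z ^+ 2 + s^-1 - 2 * c / s); last first.
  rewrite [LHS]normc_sqr zz /c -fmorphV /=.
  case: (z) (w) ww => [a b] [p q] /= ww.
  have e : s^-1 = (p ^+ 2 + q ^+ 2) * s^-1 ^+ 2 by rewrite -ww; field.
  by rewrite [X in _ + X - _]e; ring.
rewrite [leRHS](_ : _ = normc z ^+ 2 + s - 2 * c); last first.
  by rewrite [LHS]normc_sqr zz ww /c !raddfB/=; ring.
rewrite -subr_ge0 [leRHS](_ : _ = (s - 1) * (s + 1 - 2 * c) / s); last by field.
by apply: divr_ge0; [rewrite mulr_ge0 ?subr_ge0|exact: le_trans s1].
Qed.

(** Conjugation is an isometry, and outside the disk [|1/u - 1/v| = |u - v| / (|u| |v|)]; the mixed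
    case is [lipc_fold_mixed]. *)
Lemma lipc_fold : lipc 1 unit_fold.
Proof.
move=> u v; rewrite mul1r.
have [u1|u1] := leP (normc u) 1; have [v1|v1] := leP (normc v) 1.
- by rewrite !fold_disk// -rmorphB/= normc_conj.
- by rewrite lipc_fold_mixed// ltW.
- by rewrite normc_dist [leRHS]normc_dist lipc_fold_mixed// ltW.
have u0 : u != 0 by rewrite -normc_gt0 (lt_trans _ u1).
have v0 : v != 0 by rewrite -normc_gt0 (lt_trans _ v1).
rewrite (fold_outside (ltW u1)) (fold_outside (ltW v1)).
have -> : u^-1 - v^-1 = (v - u) / (u * v) by field; rewrite ?u0 ?v0.
rewrite normcM normcV normcM normc_dist ler_piMr ?normc_ge0//.
rewrite invf_le1; first by rewrite mulr_ege1// ltW.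
by rewrite mulr_gt0// normc_gt0.
Qed.

(** Induction on [n] through [x^(n+1) - y^(n+1) = (x - y) x^n + y (x^n - y^n)], where [x] and [y]
    have modulus at most 1. *)
Lemma lipc_foldX n : lipc n%:R (fun z => unit_fold z ^+ n).
Proof.
elim: n => [|n IH] u v; first by rewrite !expr0 subrr normc0 mul0r.
have -> : unit_fold u ^+ n.+1 - unit_fold v ^+ n.+1 =
  (unit_fold u - unit_fold v) * unit_fold u ^+ n +
  unit_fold v * (unit_fold u ^+ n - unit_fold v ^+ n).
  by rewrite !exprS; ring.
rewrite (le_trans (le_normcD _ _))// -nat1r [leRHS]mulrDl lerD// normcM.
  rewrite -[leRHS]mulr1 normcX ler_pM ?exprn_ge0 ?normc_ge0 ?lipc_fold//.
  by rewrite exprn_ile1 ?normc_ge0 ?normc_fold.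
by rewrite (le_trans _ (IH u v))// ler_piMl ?normc_ge0 ?normc_fold.
Qed.

(** The positive part of [log |z|]: it equals the logarithmic term of [f] outside the disk and
    vanishes inside, where the disk map has no such term. *)
Definition logplus z : C := (ln (Num.max 1 (normc z)))%:C.

(** From [ln (1 + t) <= t] with [t = (y - x) / x], and [x >= 1]. *)
Lemma ln_lip (x y : R) : 1 <= x -> x <= y -> ln y - ln x <= y - x.
Proof.
move=> x1 xy; have x0 : 0 < x by exact: lt_le_trans x1.
have y0 : 0 < y by exact: lt_le_trans xy.
rewrite -ln_div ?posrE//.
have -> : y / x = 1 + (y - x) / x by field; rewrite gt_eqF.
have yx : 0 <= (y - x) / x by rewrite divr_ge0 ?subr_ge0// ltW.
rewrite (le_trans (le_ln1Dx _))//; first by rewrite (lt_le_trans _ yx).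
by rewrite ler_pdivrMr// ler_peMr// subr_ge0.
Qed.

Lemma lipc_logplus : lipc 1 logplus.
Proof.
move=> u v; wlog uv : u v / normc v <= normc u => [H|].
  have [/H//|/ltW/H] := leP (normc v) (normc u).
  by rewrite normc_dist [normc (v - u)]normc_dist.
rewrite /logplus -rmorphB normc_real mul1r.
have m1 w : 1 <= Num.max 1 (normc w) by rewrite le_max lexx.
have vu : Num.max 1 (normc v) <= Num.max 1 (normc u).
  by rewrite ge_max m1 le_max uv orbT.
rewrite ger0_norm; last by rewrite subr_ge0 ler_ln// posrE (lt_le_trans _ (m1 _)).
rewrite (le_trans (ln_lip _ _))// (le_trans _ (normc_geB _ _))//.
have [v1|v1] := leP 1 (normc v); have [u1|u1] := leP 1 (normc u) => //.
- by have := le_trans v1 uv; rewrite leNgt u1.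
- by rewrite lerB// ltW.
by rewrite subrr subr_ge0.
Qed.

End Lipschitz.

(** * Wirtinger differentials *)

Section Wirtinger.
Context {R : realType}.
Local Notation C := (R[i]).
Implicit Types (f g : C -> C) (u v z w p q : C).

(** Real differentiability of [g] at [z], the differential being written in complex form: [p] and
    [q] are the derivatives with respect to [z] and its conjugate. *)
Definition wirtinger g z p q : Prop :=
  forall e : R, 0 < e -> exists2 d : R, 0 < d & forall w, normc w < d ->
    normc (g (z + w) - g z - (p * w + q * conjc w)) <= e * normc w.

Lemma wirtinger_quadratic g z p q (d M : R) : 0 < d ->
  (forall w, normc w < d ->
    normc (g (z + w) - g z - (p * w + q * conjc w)) <= M * normc w ^+ 2) ->
  wirtinger g z p q.
Proof.
move=> d0 gM e e0; have M0 : 0 < `|M| + 1 by rewrite ltr_wpDl.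
exists (Num.min d (e / (`|M| + 1))); first by rewrite lt_min d0 divr_gt0.
move=> w; rewrite lt_min => /andP[wd we]; rewrite (le_trans (gM _ wd))//.
rewrite expr2 mulrA ler_wpM2r ?normc_ge0//.
rewrite (@le_trans _ _ ((`|M| + 1) * normc w))//.
  by rewrite ler_wpM2r ?normc_ge0// (le_trans (ler_norm _))// lerDl.
by rewrite mulrC -ler_pdivlMr// ltW.
Qed.

Lemma wirtinger_near f g z p q (d : R) : 0 < d ->
  (forall w, normc w < d -> f (z + w) = g (z + w)) ->
  wirtinger g z p q -> wirtinger f z p q.
Proof.
move=> d0 fg gz e e0; have [d' d'0 gd'] := gz e e0.
exists (Num.min d d'); first by rewrite lt_min d0.
move=> w; rewrite lt_min => /andP[wd wd']; rewrite fg// -[in f z](addr0 z) fg ?normc0//.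
by rewrite addr0 gd'.
Qed.

Lemma wirtinger_ext f g z p q : f =1 g -> wirtinger g z p q -> wirtinger f z p q.
Proof. by move/funext=> ->. Qed.

Lemma wirtinger_add f g z p q p' q' : wirtinger f z p q -> wirtinger g z p' q' ->
  wirtinger (fun z => f z + g z) z (p + p') (q + q').
Proof.
move=> fz gz e e0; have e2 : 0 < e / 2 by rewrite divr_gt0.
have [d d0 fd] := fz _ e2; have [d' d'0 gd'] := gz _ e2.
exists (Num.min d d'); first by rewrite lt_min d0.
move=> w; rewrite lt_min => /andP[/fd wd /gd' wd'].
rewrite [X in normc X](_ : _ = (f (z + w) - f z - (p * w + q * conjc w)) +
  (g (z + w) - g z - (p' * w + q' * conjc w))); last by ring.
by rewrite (le_trans (le_normcD _ _))// (splitr e) mulrDl lerD.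
Qed.

Lemma wirtinger_conj f z p q : wirtinger f z p q ->
  wirtinger (fun z => conjc (f z)) z (conjc q) (conjc p).
Proof.
move=> fz e /fz[d d0 fd]; exists d => // w /fd; rewrite -normc_conj.
congr (normc _ <= _); rewrite !(rmorphB, rmorphD, rmorphM)/= conjcK; ring.
Qed.

Lemma wirtinger_id z : wirtinger (fun z => z) z 1 0.
Proof.
move=> e e0; exists 1 => // w _.
rewrite [X in normc X](_ : _ = 0); last by ring.
by rewrite normc0 mulr_ge0 ?normc_ge0 ?ltW.
Qed.

Lemma wirtinger_cst c z : wirtinger (fun=> c) z 0 0.
Proof.
move=> e e0; exists 1 => // w _.
rewrite [X in normc X](_ : _ = 0); last by ring.
by rewrite normc0 mulr_ge0 ?normc_ge0 ?ltW.
Qed.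

(** The error splits into three terms, each given a third of [e]: the two first-order errors times a
    fixed value, and the product of the increments, which the Lipschitz bounds make quadratic in
    [w]. *)
Lemma wirtinger_mul L M f g z p q p' q' : lipc L f -> lipc M g ->
  wirtinger f z p q -> wirtinger g z p' q' ->
  wirtinger (fun z => f z * g z) z (p * g z + f z * p') (q * g z + f z * q').
Proof.
move=> fL gM fz gz e e0.
have e3 : 0 < e / 3 by rewrite divr_gt0.
have N0 : 0 < normc (f z) + normc (g z) + 1.
  by rewrite ltr_wpDl ?addr_ge0 ?normc_ge0.
set N := _ + 1 in N0; have eN : 0 < e / 3 / N by rewrite divr_gt0.
have [d d0 fd] := fz _ eN; have [d' d'0 gd'] := gz _ eN.
have LM0 : 0 < `|L * M| + 1 by rewrite ltr_wpDl.
exists (Num.min (Num.min d d') (e / 3 / (`|L * M| + 1))).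
  by rewrite !lt_min d0 d'0 divr_gt0.
move=> w; rewrite !lt_min => /andP[/andP[/fd wd /gd' wd']] we.
rewrite [X in normc X](_ : _ =
  ((f (z + w) - f z - (p * w + q * conjc w)) * g z +
   (g (z + w) - g z - (p' * w + q' * conjc w)) * f z) +
  (f (z + w) - f z) * (g (z + w) - g z)); last by ring.
have small (c : C) x : normc c <= N -> normc x <= e / 3 / N * normc w ->
    normc (x * c) <= e / 3 * normc w.
  move=> cN xe; rewrite normcM (@le_trans _ _ (e / 3 / N * normc w * N))//.
    by rewrite ler_pM ?normc_ge0.
  by rewrite mulrAC divfK// gt_eqF.
have -> : e * normc w = (e / 3 * normc w + e / 3 * normc w) + e / 3 * normc w by field.
rewrite (le_trans (le_normcD _ _))// lerD//.
  rewrite (le_trans (le_normcD _ _))// lerD// small//.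
    by rewrite /N -addrA addrCA lerDl addr_ge0 ?normc_ge0.
  by rewrite /N -addrA lerDl addr_ge0 ?normc_ge0.
have ww (h : C -> C) K : lipc K h -> normc (h (z + w) - h z) <= K * normc w.
  by move=> hK; rewrite (le_trans (hK _ _))// [z + w - z]addrC addKr.
rewrite normcM (@le_trans _ _ (L * normc w * (M * normc w)))//.
  by rewrite ler_pM ?normc_ge0 ?ww.
rewrite mulrACA mulrA ler_wpM2r ?normc_ge0//.
rewrite (@le_trans _ _ ((`|L * M| + 1) * normc w))//.
  by rewrite ler_wpM2r ?normc_ge0// (le_trans (ler_norm _))// lerDl.
by rewrite mulrC -ler_pdivlMr// ltW.
Qed.

Lemma wirtinger_scale c f z p q : wirtinger f z p q ->
  wirtinger (fun z => c * f z) z (c * p) (c * q).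
Proof.
move=> fz e e0; have N0 : 0 < normc c + 1 by rewrite ltr_wpDl ?normc_ge0.
have [|d d0 fd] := fz (e / (normc c + 1)); first by rewrite divr_gt0.
exists d => // w /fd wd.
rewrite [X in normc X](_ : _ = c * (f (z + w) - f z - (p * w + q * conjc w)));
  last by ring.
rewrite normcM (@le_trans _ _ ((normc c + 1) * (e / (normc c + 1) * normc w)))//.
  by rewrite ler_pM ?normc_ge0// lerDl.
by rewrite mulrA [_ * (e / _)]mulrC divfK// gt_eqF.
Qed.

(** The remainder is exactly [w^2 / (z^2 (z + w))]. For [|w| < |z| - 1] the point [z + w] stays
    outside the disk, so the denominator has modulus at least 1. *)
Lemma wirtinger_inv z : 1 < normc z -> wirtinger (fun z => z^-1) z (- z ^- 2) 0.
Proof.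
move=> z1; apply: (@wirtinger_quadratic _ _ _ _ (normc z - 1) 1).
  by rewrite subr_gt0.
move=> w; rewrite ltrBrDr -ltrBrDl => wz.
have zw1 : 1 <= normc (z + w).
  rewrite ltW// (lt_le_trans wz)//.
  by have := normc_geB z (- w); rewrite normcN opprK.
have z0 : z != 0 by rewrite -normc_gt0 (lt_trans _ z1).
have zw0 : z + w != 0 by rewrite -normc_gt0 (lt_le_trans _ zw1).
rewrite [X in normc X](_ : _ = w ^+ 2 / (z ^+ 2 * (z + w))); last first.
  by field; rewrite ?z0 ?zw0.
rewrite normcM normcX mulrC ler_wpM2r ?exprn_ge0 ?normc_ge0//.
rewrite normcV normcM normcX invf_le1.
  by rewrite mulr_ege1// exprn_ege1// ltW.
by rewrite mulr_gt0 ?exprn_gt0 ?normc_gt0.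
Qed.

(** With [x = |1 + u|], combine [ln x <= x - 1 <= (x^2 - 1) / 2] and the expansion of [x^2]. *)
Lemma ln_normc_upper (u : C) : 1 + u != 0 ->
  ln (normc (1 + u)) <= complex.Re u + normc u ^+ 2 / 2.
Proof.
move=> u0; have n0 : 0 < normc (1 + u) by rewrite normc_gt0.
have := @le_ln1Dx R (normc (1 + u) - 1).
rewrite (_ : 1 + (_ - 1) = normc (1 + u)) => [le1|]; last by ring.
rewrite (le_trans (le1 _))//; first by rewrite ltrBrDl subrr.
have : normc (1 + u) ^+ 2 = 1 + 2 * complex.Re u + normc u ^+ 2.
  by rewrite !normc_sqr; case: (u) => a b /=; ring.
have := sqr_ge0 (normc (1 + u) - 1); nra.
Qed.

(** The lower bound is the upper bound for the inverse [1 / (1 + u) = 1 - v], [v = u / (1 + u)].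
    Since [|v| <= 2 |u|], the terms [|u v|] and [|v|^2 / 2] are at most [2 |u|^2] each, whence the
    constant 4. *)
Lemma ln_normc_approx (u : C) : normc u <= 1 / 2 ->
  `|ln (normc (1 + u)) - complex.Re u| <= 4 * normc u ^+ 2.
Proof.
move=> u2.
have n2 : 1 / 2 <= normc (1 + u).
  by have := normc_geB 1 (- u); rewrite normc1 normcN opprK; lra.
have u0 : 1 + u != 0 by rewrite -normc_gt0 (lt_le_trans _ n2).
have n0 : 0 < normc (1 + u) by rewrite normc_gt0.
have := ln_normc_upper u0.
pose v := u / (1 + u).
have uv : 1 - v = (1 + u)^-1 by rewrite /v; field.
have v0 : 1 + - v != 0 by rewrite uv invr_eq0.
have := ln_normc_upper v0; rewrite uv normcV lnV ?posrE//.
have vu : normc v <= 2 * normc u.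
  rewrite /v normcM normcV ler_pdivrMr//.
  have := normc_ge0 u; nra.
have -> : - v = u * v - u by rewrite /v; field.
have := Re_le_normc (u * v); rewrite normcM ler_norml => /andP[_ h1].
rewrite raddfB/= => h2 h3.
have h4 : normc (u * v - u) = normc v.
  by rewrite -[RHS]normcN; congr normc; rewrite /v; field.
move: h2; rewrite h4 => h2.
have := normc_ge0 u; have := normc_ge0 v => v1 u1.
rewrite ler_norml; apply/andP; split; nra.
Qed.

(** With [u = w / z] the increment is [ln |1 + u|], and its linear part [Re u] is the stated
    differential applied to [w]. *)
Lemma wirtinger_ln z : z != 0 ->
  wirtinger (fun z => (ln (normc z))%:C) z (2^-1 / z) (2^-1 / conjc z).
Proof.
move=> z0; have n0 : 0 < normc z by rewrite normc_gt0.
apply: (@wirtinger_quadratic _ _ _ _ (normc z / 2) (4 / normc z ^+ 2)).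
  by rewrite divr_gt0.
move=> w wz; pose u := w / z.
have un : normc u = normc w / normc z by rewrite /u normcM normcV.
have u2 : normc u <= 1 / 2 by rewrite un ler_pdivrMr// div1r mulrC ltW.
have n2 : 1 / 2 <= normc (1 + u).
  by have := normc_geB 1 (- u); rewrite normc1 normcN opprK; lra.
have -> : z + w = z * (1 + u) by rewrite /u; field.
have -> : 2^-1 / z * w + 2^-1 / conjc z * conjc w = (complex.Re u)%:C.
  rewrite ReJ_add /u rmorphM/= fmorphV/=; ring.
rewrite normcM lnM ?posrE ?(lt_le_trans _ n2)// -!rmorphB normc_real.
rewrite [X in `|X - _|]addrC addKr (le_trans (ln_normc_approx u2))// un.
by rewrite expr_div_n mulrA mulrAC.
Qed.

(** Off the unit circle [unit_fold] coincides near [z] with conjugation or with inversion; powers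
    follow by the product rule. *)
Lemma wirtinger_foldX z n : normc z != 1 ->
  exists p q, wirtinger (fun z => unit_fold z ^+ n) z p q.
Proof.
move=> z1; have [p [q fz]] : exists p q, wirtinger unit_fold z p q.
  move: z1; rewrite neq_lt => /orP[z1|z1].
    exists (conjc 0), (conjc 1).
    apply: (@wirtinger_near _ (@conjc R) _ _ _ (1 - normc z)).
    - by rewrite subr_gt0.
    - move=> w; rewrite ltrBrDl => zw.
      by rewrite fold_disk// (le_trans (le_normcD _ _))// ltW.
    - exact: wirtinger_conj (@wirtinger_id z).
  exists (- z ^- 2), 0.
  apply: (@wirtinger_near _ (fun z => z^-1) _ _ _ (normc z - 1)).
  - by rewrite subr_gt0.
  - move=> w; rewrite ltrBrDr -ltrBrDl => zw.
    rewrite fold_outside// ltW// (lt_le_trans zw)//.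
    by have := normc_geB z (- w); rewrite normcN opprK.
  - exact: wirtinger_inv.
elim: n => [|n [p' [q' IH]]].
  by exists 0, 0; exact: (wirtinger_cst 1).
exists (p * unit_fold z ^+ n + unit_fold z * p'),
  (q * unit_fold z ^+ n + unit_fold z * q').
apply: wirtinger_ext => [w|]; first by rewrite exprS.
exact: wirtinger_mul (@lipc_fold R) (@lipc_foldX R n) fz IH.
Qed.

Lemma wirtinger_logplus z : normc z != 1 ->
  exists p q, wirtinger logplus z p q.
Proof.
rewrite neq_lt => /orP[z1|z1].
  exists 0, 0; apply: (@wirtinger_near _ (fun=> 0) _ _ _ (1 - normc z)).
  - by rewrite subr_gt0.
  - move=> w; rewrite ltrBrDl => zw.
    by rewrite /logplus max_l ?ln1// (le_trans (le_normcD _ _))// ltW.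
  - exact: wirtinger_cst.
exists (2^-1 / z), (2^-1 / conjc z).
apply: (@wirtinger_near _ (fun z => (ln (normc z))%:C) _ _ _ (normc z - 1)).
- by rewrite subr_gt0.
- move=> w; rewrite ltrBrDr -ltrBrDl => zw.
  rewrite /logplus max_r// ltW// (lt_le_trans zw)//.
  by have := normc_geB z (- w); rewrite normcN opprK.
- by apply: wirtinger_ln; rewrite -normc_gt0 (lt_trans _ z1).
Qed.

Lemma wirtinger_sum (f : nat -> C -> C) m n z :
  (forall i, exists p q, wirtinger (f i) z p q) ->
  exists p q, wirtinger (fun z => \sum_(m <= i < n) f i z) z p q.
Proof.
move=> fz; elim: n => [|n [p [q IH]]].
  exists 0, 0; apply: wirtinger_ext (wirtinger_cst 0 z) => w.
  by rewrite big_geq.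
case: (leqP m n) => mn; last first.
  exists 0, 0; apply: wirtinger_ext (wirtinger_cst 0 z) => w.
  by rewrite big_geq.
have [p' [q' fn]] := fz n; exists (p + p'), (q + q').
by apply: wirtinger_ext (wirtinger_add IH fn) => w; rewrite big_nat_recr.
Qed.

(* Evaluate the differential in a direction [v] where [p * v] and
   [q * conjc v] have the same argument. *)
Lemma wirtinger_lipc L f z p q : lipc L f -> wirtinger f z p q ->
  normc p + normc q <= L.
Proof.
move=> fL fz.
have [v v1 pq] : exists2 v, normc v = 1 &
    normc (p * v + q * conjc v) = normc p + normc q.
  have [->|p0] := eqVneq p 0.
    by exists 1; rewrite ?normc1// mul0r add0r conjc1 mulr1 normc0 add0r.
  have [->|q0] := eqVneq q 0.
    by exists 1; rewrite ?normc1// mul0r addr0 mulr1 normc0 addr0.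
  have np : (normc p)%:C != 0 by rewrite -normc_eq0 normc_real normr_eq0 normc_eq0.
  have nq : (normc q)%:C != 0 by rewrite -normc_eq0 normc_real normr_eq0 normc_eq0.
  (* This choice of [v ^+ 2] makes [q * conjc v] the positive multiple [|q| / |p|] of [p * v]. *)
  pose v := sqrtc ((normc p)%:C / (normc q)%:C * (q / p)).
  have v2 : v ^+ 2 = (normc p)%:C / (normc q)%:C * (q / p) by rewrite sqr_sqrtc.
  have v1 : normc v = 1.
    apply/eqP; rewrite -(@eqrXn2 _ 2) ?normc_ge0// expr1n -normcX v2.
    rewrite !normcM !normcV !normc_real !ger0_norm ?normc_ge0//; apply/eqP.
    by field; rewrite !normc_eq0 p0.
  exists v => //.
  have -> : q * conjc v = (normc q)%:C / (normc p)%:C * (p * v).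
    have e : q = (normc q)%:C / (normc p)%:C * p * v ^+ 2.
      by rewrite v2; field; rewrite ?p0 ?np ?nq.
    by rewrite {1}e expr2 -!mulrA mulc_conj v1 expr1n mulr1.
  rewrite -[X in X + _]mul1r -mulrDl !normcM v1 mulr1.
  have -> : 1 + (normc q)%:C / (normc p)%:C = (1 + normc q / normc p)%:C.
    by rewrite rmorphD rmorphM fmorphV.
  rewrite normc_real ger0_norm; last by rewrite addr_ge0 ?divr_ge0 ?normc_ge0.
  by field; rewrite normc_eq0.
apply/ler_addgt0Pr => e e0; have [d d0 fd] := fz e e0.
have d2 : 0 < d / 2 by rewrite divr_gt0.
(* A small nonzero multiple of [v]: the modulus of the differential at [w] is at most the Lipschitz
   bound plus the error [e * normc w], and [normc w] cancels. *)
pose w := (d / 2)%:C * v.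
have wn : normc w = d / 2 by rewrite normcM v1 mulr1 normc_real gtr0_norm.
have wd : normc w < d by rewrite wn; lra.
have lin : normc (p * w + q * conjc w) = (normc p + normc q) * normc w.
  rewrite (_ : p * w + q * conjc w = (d / 2)%:C * (p * v + q * conjc v)).
    by rewrite normcM pq wn normc_real gtr0_norm// mulrC.
  have -> : conjc w = (d / 2)%:C * conjc v.
    by rewrite -[X in _ = X * _]conjc_real -rmorphM.
  by rewrite /w; ring.
have w0 : 0 < normc w by rewrite wn.
rewrite -(ler_pM2r w0) -lin mulrDl.
have := le_normcD (f (z + w) - f z) (- (f (z + w) - f z - (p * w + q * conjc w))).
rewrite normcN [X in normc X](_ : _ = p * w + q * conjc w); last by ring.
move/le_trans; apply; rewrite lerD ?fd//.
by rewrite (le_trans (fL _ _))// [z + w]addrC addrK.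
Qed.

End Wirtinger.

(** * Limits of differentials, and partial derivatives *)

Section Differentials.
Context {R : realType}.
Local Notation C := (R[i]).
Implicit Types (f g h : C -> C) (u v z w p q : C).

Lemma lipc_sub_comm L f g : lipc L (fun z => f z - g z) -> lipc L (fun z => g z - f z).
Proof.
move=> fg u v; rewrite -normcN; apply: le_trans (fg u v).
by rewrite le_eqVlt; apply/orP; left; apply/eqP; congr normc; ring.
Qed.

Lemma wirtinger_sub f g z p q p' q' : wirtinger f z p q -> wirtinger g z p' q' ->
  wirtinger (fun z => f z - g z) z (p - p') (q - q').
Proof.
move=> fz gz; have := wirtinger_add fz (wirtinger_scale (-1) gz).
by rewrite !mulN1r; apply: wirtinger_ext => w; rewrite mulN1r.
Qed.

(** Convergence in the Lipschitz seminorm preserves differentiability. By [wirtinger_lipc], applied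
    to [g n - g m], the coefficients of the differentials are Cauchy with rate [e]; their limits
    form the differential of [h]. *)
Lemma wirtinger_lim h (g : nat -> C -> C) (e : nat -> R) z :
  e @ \oo --> (0 : R) ->
  (forall n, lipc (e n) (fun z => h z - g n z)) ->
  (forall n, exists p q, wirtinger (g n) z p q) ->
  exists p q, wirtinger h z p q.
Proof.
move=> e0 hg gz.
have [pq gpq] : exists pq : nat -> C * C,
    forall n, wirtinger (g n) z (pq n).1 (pq n).2.
  have /choice[pq gpq] : forall n, exists pq : C * C, wirtinger (g n) z pq.1 pq.2.
    by move=> n; have [p [q ?]] := gz n; exists (p, q).
  by exists pq.
have pqB n m : normc ((pq n).1 - (pq m).1) + normc ((pq n).2 - (pq m).2) <= e n + e m.
  apply: wirtinger_lipc (wirtinger_sub (gpq n) (gpq m)).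
  have := lipc_add (lipc_sub_comm (hg n)) (hg m).
  by congr (lipc _ _); apply/funext => w; ring.
have [n m|p [_ pn]] := @cvg_normc_cauchy R (fun n => (pq n).1) e e0.
  by rewrite (le_trans _ (pqB n m))// lerDl normc_ge0.
have [n m|q [_ qn]] := @cvg_normc_cauchy R (fun n => (pq n).2) e e0.
  by rewrite (le_trans _ (pqB n m))// lerDr normc_ge0.
exists p, q => d d0; have d4 : 0 < d / 4 by rewrite divr_gt0.
have /cvgrPdist_lt/(_ _ d4)[N _ /(_ N (leqnn N))/=] := e0.
rewrite sub0r normrN => /(le_lt_trans (ler_norm _)) eN.
have [s s0 gs] := gpq N _ d4; exists s => // w /gs ws.
(* Four errors, a quarter of [d] each: the increment of [h - g N], the differentiability error of
   [g N], and the distances of its two coefficients from their limits. *)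
rewrite [X in normc X](_ : _ =
  ((h (z + w) - g N (z + w) - (h z - g N z)) +
   (g N (z + w) - g N z - ((pq N).1 * w + (pq N).2 * conjc w))) +
  (((pq N).1 - p) * w + ((pq N).2 - q) * conjc w)); last by ring.
have -> : d * normc w = d / 4 * normc w + d / 4 * normc w +
  (d / 4 * normc w + d / 4 * normc w) by field.
rewrite (le_trans (le_normcD _ _))// lerD// (le_trans (le_normcD _ _))// lerD//.
- rewrite (le_trans (hg N _ _))// [z + w - z]addrC addKr.
  by rewrite ler_wpM2r ?normc_ge0// ltW.
- by rewrite normcM ler_wpM2r ?normc_ge0// (le_trans (pn N))// ltW.
- by rewrite normcM normc_conj ler_wpM2r ?normc_ge0// (le_trans (qn N))// ltW.
Qed.

Lemma is_derive_littleo (g : R -> R) (l : R) :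
  (forall e : R, 0 < e -> exists2 d : R, 0 < d & forall t, `|t| < d ->
    `|g t - g 0 - t * l| <= e * `|t|) ->
  is_derive (0 : R) 1 g l.
Proof.
move=> gl.
have cl : (fun t : R => t^-1 *: (g (t *: 1 + 0) - g 0)) @ 0^' --> l.
  apply/cvgrPdist_le => e e0; have [d d0 gd] := gl e e0.
  near=> t; have t0 : t != 0 by near: t; exact: nbhs_dnbhs_neq.
  rewrite addr0 -[t *: 1]/(t * 1) mulr1 -[_ *: _]/(_ * _).
  have -> : l - t^-1 * (g t - g 0) = - (g t - g 0 - t * l) / t by field.
  rewrite normrM normrN normfV ler_pdivrMr ?normr_gt0// gd//.
  near: t; apply: dnbhs0_lt; exact: d0.
apply: DeriveDef; first by apply/cvg_ex; exists l.
by rewrite /derive; apply/cvg_lim.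
Unshelve. all: by end_near. Qed.

(** Treats all four partial derivatives at once: [r] will be the real or imaginary part, and [v]
    will be 1 or [i]. *)
Lemma is_derive_wirtinger f z p q v (r : C -> R) :
  (forall u w, r (u - w) = r u - r w) -> (forall u, `|r u| <= normc u) ->
  (forall (t : R) u, r (t%:C * u) = t * r u) ->
  normc v = 1 -> wirtinger f z p q ->
  is_derive (0 : R) 1 (fun t : R => r (f (z + t%:C * v))) (r (p * v + q * conjc v)).
Proof.
move=> rB rn rZ v1 fz; apply: is_derive_littleo => e /fz[d d0 fd].
exists d => // t td.
have tv : normc (t%:C * v) = `|t| by rewrite normcM v1 normc_real mulr1.
rewrite -rZ mul0r addr0 -!rB (le_trans (rn _))// -tv.
have -> : t%:C * (p * v + q * conjc v) = p * (t%:C * v) + q * conjc (t%:C * v).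
  by rewrite rmorphM [X in q * (X * _)]conjc_real; ring.
by rewrite fd// tv.
Qed.

(** The differential sends 1 to [p + q] and [i] to [i (p - q)]; these are [dx f z] and [dy f z], and
    solving for [p] and [q] gives [dz] and [dzbar]. *)
Lemma wirtinger_has_partials f z p q : wirtinger f z p q ->
  [/\ has_partials f z, dz f z = p & dzbar f z = q].
Proof.
move=> fz.
have ReZ (t : R) (u : C) : complex.Re (t%:C * u) = t * complex.Re u.
  by case: u => a b /=; rewrite mul0r subr0.
have ImZ (t : R) (u : C) : complex.Im (t%:C * u) = t * complex.Im u.
  by case: u => a b /=; rewrite mul0r addr0.
have i1 : normc 'i%C = 1 :> R by rewrite /= expr0n/= expr1n add0r sqrtr1.
have ReB : forall u w : C, complex.Re (u - w) = complex.Re u - complex.Re w.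
  by move=> u w; rewrite raddfB.
have ImB : forall u w : C, complex.Im (u - w) = complex.Im u - complex.Im w.
  by move=> u w; rewrite raddfB.
have Rex := is_derive_wirtinger ReB (@Re_le_normc R) ReZ (@normc1 R) fz.
have Imx := is_derive_wirtinger ImB (@Im_le_normc R) ImZ (@normc1 R) fz.
have Rey := is_derive_wirtinger ReB (@Re_le_normc R) ReZ i1 fz.
have Imy := is_derive_wirtinger ImB (@Im_le_normc R) ImZ i1 fz.
have e1 (r : C -> R) :
    (fun t : R => r (f (z + t%:C * 1))) = (fun t => r (f (z + t%:C))).
  by apply/funext => t; rewrite mulr1.
have ei (r : C -> R) :
    (fun t : R => r (f (z + t%:C * 'i%C))) = (fun t => r (f (z + t *i))).
  apply/funext => t; congr (r (f (z + _))); apply/eqP.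
  by rewrite eq_complex /=; apply/andP; split; apply/eqP; ring.
rewrite !e1 in Rex Imx; rewrite !ei in Rey Imy.
have dxE : dx f z = p + q.
  rewrite /dx !derive1E (@derive_val _ _ _ _ _ _ _ Rex) (@derive_val _ _ _ _ _ _ _ Imx).
  by rewrite conjc1 !mulr1; case: (p + q).
have dyE : dy f z = 'i%C * (p - q).
  rewrite /dy !derive1E (@derive_val _ _ _ _ _ _ _ Rey) (@derive_val _ _ _ _ _ _ _ Imy).
  rewrite (_ : conjc 'i%C = - 'i%C :> C) ?[p * _]mulrC ?mulrN ?[q * _]mulrC -?mulrBr.
    by case: ('i * (p - q)).
  by apply/eqP; rewrite eq_complex /= oppr0 !eqxx.
have ii : 'i%C * 'i%C = -1 :> C by rewrite -expr2 sqr_i.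
have n2 : (2 : C) != 0 by rewrite pnatr_eq0.
split; first by split; exact: ex_derive.
- rewrite /dz. rewrite dxE dyE mulrA ii; by field.
- rewrite /dzbar. rewrite dxE dyE mulrA ii; by field.
Qed.

End Differentials.

(** * Lipschitz perturbations of a similarity *)

Section LipschitzPerturbation.
Context {R : realType}.
Local Notation C := (R[i]).
Context (alpha : C) (k : R) (h : C -> C).
Context (a0 : alpha != 0) (k01 : 0 < k < 1) (hL : lipc (k * normc alpha) h).

Local Notation F := (fun z => alpha * z + h z).

Let an0 : 0 < normc alpha. Proof. by rewrite normc_gt0. Qed.

Lemma perturbation_lower u v :
  (1 - k) * normc alpha * normc (u - v) <= normc (F u - F v).
Proof.
have := normc_geB (alpha * (u - v)) (- (h u - h v)).
rewrite normcN opprK normcM => le1.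
rewrite [leRHS](_ : _ = normc (alpha * (u - v) + (h u - h v))); last first.
  by congr normc; ring.
apply: le_trans le1; have := hL u v; lra.
Qed.

(** Solving [F z = w] means finding a fixed point of [z -> (w - h z) / alpha], a [k]-contraction.
    The lower bound gives injectivity and makes the inverse Lipschitz with constant
    [1 / ((1 - k) |alpha|)]. *)
Lemma perturbation_homeomorphism : plane_homeomorphism F.
Proof.
have k0 : 0 < 1 - k by case/andP: k01 => _; rewrite subr_gt0.
have FL : lipc (normc alpha * 1 + k * normc alpha) F.
  exact: lipc_add (lipc_scale _ (@lipc_id R)) hL.
split; first exact: lipc_continuous FL.
have Finj : injective F.
  move=> u v Fuv; apply/eqP; rewrite -subr_eq0 -normc_eq0 eq_le normc_ge0 andbT.
  have := perturbation_lower u v; rewrite Fuv subrr normc0 pmulr_rle0//.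
  by rewrite mulr_gt0.
have Fsurj w : exists z, F z = w.
  have [||z zw] := @lipc_iter_fixpoint R k (fun z => (w - h z) / alpha).
  - by case/andP: k01 => /ltW -> ->.
  - move=> u v; rewrite -mulrBl normcM normcV ler_pdivrMr// mulrAC.
    apply: le_trans (hL u v); rewrite normc_dist le_eqVlt.
    by apply/orP; left; apply/eqP; congr normc; ring.
  by exists z; rewrite -{1}zw mulrC divfK// subrK.
have [G GK] := choice Fsurj.
exists G; split => //; last by move=> z; apply: Finj; rewrite GK.
apply: (@lipc_continuous _ ((1 - k) * normc alpha)^-1) => u v.
rewrite -[leRHS]mulrC ler_pdivlMr ?mulr_gt0// mulrC.
by rewrite -{2}(GK u) -{2}(GK v) perturbation_lower.
Qed.

(** [|q| <= k |alpha| - |p| <= k (|alpha| - |p|) <= k |alpha + p|], where [dz F z = alpha + p] and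
    [dzbar F z = q]. Also [|p| <= k |alpha| < |alpha|], so [dz F z] is nonzero. *)
Lemma perturbation_dilatation z : (exists p q, wirtinger h z p q) ->
  [/\ has_partials F z, dz F z != 0 & normc (dilatation F z) <= k].
Proof.
move=> [p [q hz]]; case/andP: k01 => k0 k1.
have pq := wirtinger_lipc hL hz.
have [FP Fz Fzb] := wirtinger_has_partials
  (wirtinger_add (wirtinger_scale alpha (wirtinger_id z)) hz).
rewrite mulr1 in Fz; rewrite mulr0 add0r in Fzb.
have ap : normc alpha - normc p <= normc (alpha + p).
  by have := normc_geB alpha (- p); rewrite normcN opprK.
have := normc_ge0 q; have := normc_ge0 p => p0 q0.
have ak : 0 < (1 - k) * normc alpha by rewrite mulr_gt0 ?subr_gt0.
have ap0 : 0 < normc (alpha + p) by lra.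
have kap := ler_wpM2l (ltW k0) ap.
have kp : k * normc p <= normc p by rewrite ler_piMl// ltW.
split => //; first by rewrite Fz -normc_gt0.
rewrite /dilatation Fz Fzb normcM normcV ler_pdivrMr//; lra.
Qed.

End LipschitzPerturbation.

(** The choice [d = e / (|L| + 1)] works on every horizontal and vertical line, hence on almost
    every one. *)
Lemma lipc_ACL {R : realType} L (f : R[i] -> R[i]) : lipc L f -> ACL f.
Proof.
move=> fL.
have ac a b (g : R -> R[i]) : (forall x y, normc (g x - g y) <= L * `|x - y|) ->
    absolutely_continuous_on a b g.
  move=> gL e e0; have L0 : 0 < `|L| + 1 by rewrite ltr_wpDl.
  exists (e / (`|L| + 1)); first by rewrite divr_gt0.
  move=> n l r lr _; rewrite ltr_pdivlMr// mulrC; apply: le_lt_trans.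
  rewrite mulr_sumr; apply: ler_sum => i _.
  rewrite (le_trans (gL _ _))// ger0_norm ?subr_ge0; last by case: (lr i) => _ [].
  rewrite ler_wpM2r//; first by rewrite subr_ge0; case: (lr i) => _ [].
  by rewrite (le_trans (ler_norm _))// lerDl.
move=> a b c d _ _; split; apply: aeW => x _; apply: ac => s t;
  rewrite (le_trans (fL _ _))//= subrr expr0n/= ?addr0 ?add0r sqrtr_sqr//.
Qed.

(** * Polar form, continuous arguments and the null set of the unit circle *)

Section Argument.
Context {R : realType}.
Local Notation C := (R[i]).
Implicit Types (z u v : C).

Lemma expiD (s t : R) : expi (s + t) = expi s * expi t.
Proof.
rewrite /expi cosD sinD; apply/eqP; rewrite eq_complex /=.
by apply/andP; split; apply/eqP; ring.
Qed.

Lemma normc_expi (t : R) : normc (expi t) = 1.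
Proof. by rewrite /expi /= cos2Dsin2 sqrtr1. Qed.

Lemma expi_conj (t : R) : expi t * conjc (expi t) = 1.
Proof. by rewrite mulc_conj normc_expi expr1n. Qed.

(** On the right half-plane [atan (Im u / Re u)] is an argument that depends continuously on [u]. *)
Lemma polar_halfplane u : 0 < complex.Re u ->
  u = (normc u)%:C * expi (atan (complex.Im u / complex.Re u)).
Proof.
case: u => a b /= a0; set x := b / a.
have ca : cos (atan x) = (Num.sqrt (1 + x ^+ 2))^-1 by rewrite cos_atan.
have c0 : 0 < cos (atan x).
  by rewrite ca invr_gt0 sqrtr_gt0 ltr_pwDl// sqr_ge0.
have sa : sin (atan x) = x * cos (atan x).
  by rewrite -{2}[x]atanK /tan divfK// gt_eqF.
have nE : Num.sqrt (a ^+ 2 + b ^+ 2) = a * Num.sqrt (1 + x ^+ 2).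
  rewrite -[a in RHS]gtr0_norm// -sqrtr_sqr -sqrtrM ?sqr_ge0//.
  by congr Num.sqrt; rewrite /x; field; rewrite gt_eqF.
have s0 : Num.sqrt (1 + x ^+ 2) != 0.
  by rewrite gt_eqF// sqrtr_gt0 ltr_pwDl// sqr_ge0.
rewrite nE /expi sa ca; apply/eqP; rewrite eq_complex /=.
by apply/andP; split; apply/eqP; rewrite /x; field; rewrite ?s0 ?gt_eqF.
Qed.

(* A square root of [z] lies, up to sign, in the right half-plane or on the
   imaginary axis; the latter means that [z] is a negative real. *)
Lemma polar z : exists t, z = (normc z)%:C * expi t.
Proof.
have sqr_polar (w : C) : 0 < complex.Re w ->
    exists t, w ^+ 2 = (normc (w ^+ 2))%:C * expi t.
  move=> w0; have := polar_halfplane w0; set t := atan _ => e; exists (t + t).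
  by rewrite normcX rmorphXn/= expiD {1}e; ring.
have [Re0|Re0|Re0] := ltgtP 0 (complex.Re (sqrtc z)).
- by rewrite -[z]sqr_sqrtc; exact: sqr_polar.
- by rewrite -[z]sqr_sqrtc -sqrrN; apply: sqr_polar; rewrite raddfN oppr_gt0.
exists pi; rewrite -[z]sqr_sqrtc normcX /expi cospi sinpi.
case: (sqrtc z) Re0 => a b /= <-.
rewrite expr0n/= add0r sqr_sqrtr ?sqr_ge0//.
by apply/eqP; rewrite eq_complex /=; apply/andP; split; apply/eqP; ring.
Qed.

(** Continuity by components, since the arguments below are real functions of [Re] and [Im]. *)
Definition continuousc (g : R -> C) : Prop :=
  continuous (fun t => complex.Re (g t)) /\ continuous (fun t => complex.Im (g t)).

Lemma continuousc_cst z : continuousc (fun=> z).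
Proof. by split=> t; exact: cvg_cst. Qed.

Lemma continuousc_expi : continuousc expi.
Proof. by split=> t; [exact: continuous_cos|exact: continuous_sin]. Qed.

Lemma continuousc_conj g : continuousc g -> continuousc (fun t => conjc (g t)).
Proof.
move=> [gr gi]; split=> t.
  rewrite (_ : (fun t => _) = (fun t => complex.Re (g t))); first exact: gr.
  by apply/funext => s; case: (g s).
rewrite (_ : (fun t => _) = (fun t => - complex.Im (g t))).
  by apply: cvgN; exact: gi.
by apply/funext => s; case: (g s).
Qed.

Lemma continuousc_add f g : continuousc f -> continuousc g ->
  continuousc (fun t => f t + g t).
Proof.
move=> [fr fi] [gr gi]; split=> t.
  by under eq_fun do rewrite raddfD; apply: cvgD; [exact: fr|exact: gr].
by under eq_fun do rewrite raddfD; apply: cvgD; [exact: fi|exact: gi].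
Qed.

Lemma continuousc_mul f g : continuousc f -> continuousc g ->
  continuousc (fun t => f t * g t).
Proof.
have ReM (z w : C) : complex.Re (z * w) =
  complex.Re z * complex.Re w - complex.Im z * complex.Im w by case: z; case: w.
have ImM (z w : C) : complex.Im (z * w) =
  complex.Re z * complex.Im w + complex.Im z * complex.Re w by case: z; case: w.
move=> [fr fi] [gr gi]; split=> t.
  under eq_fun do rewrite ReM; apply: cvgB; apply: cvgM.
  - exact: fr.
  - exact: gr.
  - exact: fi.
  - exact: gi.
under eq_fun do rewrite ImM; apply: cvgD; apply: cvgM.
- exact: fr.
- exact: gi.
- exact: fi.
- exact: gr.
Qed.

Lemma continuousc_lipc L (h : C -> C) g : lipc L h -> continuousc g ->
  continuousc (fun t => h (g t)).
Proof.
move=> hL [gr gi].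
have small t (e : R) : 0 < e -> \forall s \near t, normc (h (g t) - h (g s)) < e.
  move=> e0; have L0 : 0 < `|L| + 1 by rewrite ltr_wpDl.
  have e2 : 0 < e / (`|L| + 1) / 2 by rewrite !divr_gt0.
  have /cvgrPdist_lt/(_ _ e2) r := gr t; have /cvgrPdist_lt/(_ _ e2) i := gi t.
  near=> s; rewrite (le_lt_trans (hL _ _))//.
  rewrite (@le_lt_trans _ _ ((`|L| + 1) * normc (g t - g s)))//.
    by rewrite ler_wpM2r ?normc_ge0// (le_trans (ler_norm _))// lerDl.
  rewrite mulrC -ltr_pdivlMr// (le_lt_trans (normc_le_ReIm _))// [ltRHS]splitr.
  by rewrite !raddfB ltrD//=; [near: s; exact: r|near: s; exact: i].
split=> t; apply/cvgrPdist_lt => e e0; apply: filterS (small t e e0) => s.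
  by apply: le_lt_trans; rewrite -raddfB Re_le_normc.
by apply: le_lt_trans; rewrite -raddfB Im_le_normc.
Unshelve. all: by end_near. Qed.

(* Along a circle, [F (p + r e^it) - F p = alpha r e^it (1 + q t)] with
   [|q t| <= k < 1], so [1 + q t] stays in the right half-plane. *)
Lemma perturbation_sense_preserving (alpha : C) (k : R) (h : C -> C) :
  alpha != 0 -> k < 1 -> lipc (k * normc alpha) h ->
  sense_preserving_on setT (fun z => alpha * z + h z).
Proof.
move=> a0 k1 hL p r r0 _.
have an0 : 0 < normc alpha by rewrite normc_gt0.
have rn0 : r%:C != 0 :> C by rewrite fmorph_eq0 gt_eqF.
(* [conjc (expi t)] is the inverse of [expi t], so [u t] is the factor [1 + q t]. *)
pose u t := 1 + (h (p + r%:C * expi t) - h p) * conjc (expi t) / (alpha * r%:C).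
have uE t : alpha * (p + r%:C * expi t) + h (p + r%:C * expi t) - (alpha * p + h p) =
    alpha * r%:C * expi t * u t.
  rewrite /u; set d := h _ - h p.
  rewrite [RHS](_ : _ = alpha * r%:C * expi t + expi t * conjc (expi t) * d).
    by rewrite expi_conj /d; ring.
  by field; rewrite a0 rn0.
have ub t : normc (u t - 1) <= k.
  rewrite /u addrC addKr !normcM normcV normc_conj normc_expi mulr1 normcM.
  rewrite normc_real gtr0_norm// ler_pdivrMr ?mulr_gt0// mulrA.
  rewrite (le_trans (hL _ _))// [p + _ - p]addrC addKr normcM normc_expi mulr1.
  by rewrite normc_real gtr0_norm.
have Reu t : 0 < complex.Re (u t).
  have := le_trans (Re_le_normc (u t - 1)) (ub t).
  by rewrite raddfB/= ler_norml => /andP[]; lra.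
have [t0 at0] := polar alpha.
(* Arguments of the factors [alpha], [expi t] and [u t], added. The last one is periodic, so only
   [t] contributes to the winding. *)
exists (fun t => t0 + t + atan (complex.Im (u t) / complex.Re (u t))); split.
- have [ur ui] : continuousc u.
    apply: continuousc_add; first exact: continuousc_cst.
    apply: continuousc_mul; last exact: continuousc_cst.
    apply: continuousc_mul; last exact: continuousc_conj continuousc_expi.
    apply: continuousc_add; last exact: continuousc_cst.
    apply: (continuousc_lipc hL); apply: continuousc_add.
      exact: continuousc_cst.
    by apply: continuousc_mul; [exact: continuousc_cst|exact: continuousc_expi].
  move=> t; apply: cvgD; first by apply: cvgD; [exact: cvg_cst|exact: cvg_id].
  apply: (@continuous_comp _ _ _ (fun t => complex.Im (u t) / complex.Re (u t)) atan).
    by apply: cvgM; [exact: ui|apply: cvgV; [rewrite gt_eqF|exact: ur]].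
  exact: continuous_atan.
- move=> t; rewrite uE !expiD !normcM normc_expi mulr1 normc_real gtr0_norm//.
  rewrite {1}at0 {1}(polar_halfplane (Reu t)) !rmorphM /=; ring.
- have -> : u (2 * pi) = u 0.
    rewrite /u (_ : expi (2 * pi) = expi 0)// /expi.
    by rewrite mulr_natl cos2pi sin2pi cos0 sin0.
  by ring.
Qed.

(** Each vertical slice of the circle has at most two points, so the product measure of the circle
    is the integral of 0. *)
Lemma ae_off_unit_circle : @ae_plane R (fun z => normc z != 1).
Proof.
pose N : set (R * R) := [set p | p.1 ^+ 2 + p.2 ^+ 2 = 1].
exists N; split.
- rewrite (_ : N = (fun p : R * R => p.1 ^+ 2 + p.2 ^+ 2) @^-1` [set 1])//.
  rewrite -[_ @^-1` _]setTI.
  have : measurable_fun setT (fun p : R * R => p.1 ^+ 2 + p.2 ^+ 2).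
    by apply: measurable_funD; apply: measurable_funX.
  by apply => //; exact: measurable_set1.
- rewrite /product_measure1/= integral0_eq// => x _ /=.
  apply: countable_lebesgue_measure0; apply: finite_set_countable.
  apply: (@sub_finite_set _ _ [set Num.sqrt (1 - x ^+ 2); - Num.sqrt (1 - x ^+ 2)]).
    move=> y; rewrite /xsection/= inE /N/= => xy.
    have -> : 1 - x ^+ 2 = y ^+ 2 by rewrite -xy; ring.
    rewrite sqrtr_sqr; case: (ger0P y) => _; [by left|by right; rewrite opprK].
  exact: finite_set2.
- move=> [x y] /=; rewrite /N/= => /negP; rewrite negbK => /eqP xy.
  by rewrite -(@sqr_sqrtr _ (x ^+ 2 + y ^+ 2)) ?addr_ge0 ?sqr_ge0// xy expr1n.
Qed.

End Argument.

(** * Power series in the reflected variable *)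

Section Series.
Context {R : realType}.
Local Notation C := (R[i]).

Lemma csummable_csum m (u : nat -> C) (l : C) :
  normc (cpartial m u n - l) @[n --> \oo] --> (0 : R) ->
  csummable m u /\ csum m u = l.
Proof.
move=> /cvg_normcP ul; split; first by apply/cvg_ex; exists l.
exact: (@cvg_lim C^o (@norm_hausdorff _ C^o) _ _ _ _ _ ul).
Qed.

Lemma csum_cvg m (u : nat -> C) : csummable m u ->
  normc (cpartial m u n - csum m u) @[n --> \oo] --> (0 : R).
Proof. by move=> um; apply/cvg_normcP. Qed.

Lemma csum_conj m (u : nat -> C) : csummable m u ->
  csummable m (fun n => conjc (u n)) /\
  csum m (fun n => conjc (u n)) = conjc (csum m u).
Proof.
move=> /csum_cvg um; apply: csummable_csum; apply: cvg_trans um.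
apply: near_eq_cvg; near=> n.
by rewrite -[LHS]normc_conj rmorphB rmorph_sum.
Unshelve. all: by end_near. Qed.

(** The tail [e n = T - w n] of the weighted coefficient series bounds both the values and the
    Lipschitz constants of the tails of the power series. Hence the series converges, and its
    partial sums converge in the Lipschitz seminorm, as [wirtinger_lim] requires. *)
Lemma fold_series (c : nat -> C) (m : nat) (T : R) : (m <= 1)%N ->
  (fun n => \sum_(m <= i < n) i%:R * normc (c i)) @ \oo --> T ->
  [/\ forall z, csummable m (fun n => c n * unit_fold z ^+ n),
      lipc T (fun z => csum m (fun n => c n * unit_fold z ^+ n))
    & forall z, normc z != 1 -> exists p q,
        wirtinger (fun z => csum m (fun n => c n * unit_fold z ^+ n)) z p q].
Proof.
move=> m1 cT.
(* Partial sums include index [n], so all tail indices are at least 1. An index 0, present when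
   [m = 0], stays in the head with weight 0. *)
pose w n := \sum_(m <= i < n.+1) i%:R * normc (c i).
pose u n z := \sum_(m <= i < n.+1) c i * unit_fold z ^+ i.
pose e n := T - w n.
have wT : w @ \oo --> T by move: cT; rewrite -cvg_shiftS.
have wS n j : (n <= j)%N -> w j - w n = \sum_(n.+1 <= i < j.+1) i%:R * normc (c i).
  by move=> nj; rewrite /w (@big_cat_nat _ _ _ n.+1) ?(leq_trans m1)//=
    addrAC subrr add0r.
have uS n j z : (n <= j)%N ->
    u j z - u n z = \sum_(n.+1 <= i < j.+1) c i * unit_fold z ^+ i.
  by move=> nj; rewrite /u (@big_cat_nat _ _ _ n.+1) ?(leq_trans m1)//=
    addrAC subrr add0r.
have wnd : {homo w : n j / (n <= j)%N >-> n <= j}.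
  by move=> n j nj; rewrite -subr_ge0 wS// sumr_ge0// => i _; rewrite mulr_ge0 ?normc_ge0.
have we n j : w j - w n <= e n.
  rewrite lerD2r -(cvg_lim (@Rhausdorff R) wT).
  by apply: nondecreasing_cvgn_le => //; apply/cvg_ex; exists T.
have e_ge0 n : 0 <= e n by rewrite (le_trans _ (we n n))// subrr.
have e0 : e @ \oo --> (0 : R).
  by rewrite -(subrr T); apply: cvgB => //; exact: cvg_cst.
have uB n j z : (n <= j)%N -> normc (u j z - u n z) <= e n.
  move=> nj; rewrite uS//; apply: le_trans (we n j); rewrite wS//.
  rewrite (le_trans (normc_sum _ _ _))// big_nat_cond [leRHS]big_nat_cond.
  apply: ler_sum => i /andP[/andP[ni _] _].
  rewrite normcM mulrC ler_wpM2r ?normc_ge0//.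
  (* [|unit_fold z ^+ i| <= 1 <= i], as [i] exceeds [n]. *)
  rewrite (@le_trans _ _ 1)//; first by rewrite normcX exprn_ile1 ?normc_ge0 ?normc_fold.
  by rewrite (ler_nat _ 1); exact: leq_trans ni.
have uL z : exists l, normc (u j z - l) @[j --> \oo] --> (0 : R) /\
    forall j, normc (u j z - l) <= e j.
  apply: cvg_normc_cauchy => // i j; have [ij|/ltnW ij] := leqP i j.
    by rewrite normc_dist (le_trans (uB _ _ _ ij))// lerDl.
  by rewrite (le_trans (uB _ _ _ ij))// lerDr.
have usum z : csummable m (fun n => c n * unit_fold z ^+ n) /\
    normc (u j z - csum m (fun n => c n * unit_fold z ^+ n)) @[j --> \oo] --> (0 : R).
  have [l [ul _]] := uL z.
  have [|sm ->//] := @csummable_csum m (fun n => c n * unit_fold z ^+ n) l.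
  by rewrite -cvg_shiftS.
set g := fun z => csum m _.
have uLip n : lipc (w n) (u n).
  apply: lipc_sum => i; rewrite mulrC.
  exact: lipc_scale (@lipc_foldX R i).
have gu n : lipc (e n) (fun z => g z - u n z).
  move=> x y.
  pose s z j := normc (u (j + n)%N z - g z).
  apply: (@le_of_cvg0 _ _ _ (fun j => s x j + s y j)).
    have s0 z : s z @ \oo --> (0 : R).
      by have [_] := usum z; rewrite -(cvg_shiftn n).
    by rewrite -[X in _ --> X]addr0; apply: cvgD.
  move=> j; pose N := (j + n)%N.
  (* The infinite tail is replaced by the finite one up to [N], whose Lipschitz constant is
     [w N - w n]; the replacement error vanishes as [j] grows. *)
  rewrite [X in normc X](_ : _ = ((u N x - u n x) - (u N y - u n y)) +
    (- (u N x - g x) + (u N y - g y))); last by ring.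
  rewrite (le_trans (le_normcD _ _))// lerD//; last first.
    by rewrite (le_trans (le_normcD _ _))// normcN.
  rewrite !uS ?leq_addl// (@le_trans _ _ ((w N - w n) * normc (x - y)))//.
    rewrite wS ?leq_addl//.
    apply: (@lipc_sum _ _ (fun i z => c i * unit_fold z ^+ i)) => i.
    by rewrite mulrC; exact: lipc_scale (@lipc_foldX R i).
  by rewrite ler_wpM2r ?normc_ge0.
split.
- by move=> z; have [] := usum z.
(* Tail and head constants add up to [e 0 + w 0 = T]. *)
- have := lipc_add (gu 0%N) (uLip 0%N); rewrite /e subrK.
  by congr lipc; apply/funext => z; rewrite subrK.
- move=> z z1; apply: (wirtinger_lim e0 gu) => n; apply: wirtinger_sum => i.
  have [p [q pq]] := wirtinger_foldX i z1.
  by exists (c i * p), (c i * q); exact: wirtinger_scale.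
Qed.

End Series.

Lemma homeomorphism_restrict {R : realType} (E : set R[i]) (F : R[i] -> R[i]) :
  plane_homeomorphism F -> homeomorphism_onto_image E F.
Proof.
move=> [Fc [G [Gc FG _]]]; split; first by apply: continuous_subspaceT; exact: Fc.
exists G; split; last by move=> z _; exact: FG.
by apply: continuous_subspaceT; exact: Gc.
Qed.

(** * Assembling the extension from the expansion of [f] *)

Section Extension.
Context {R : realType}.
Local Notation C := (R[i]).
Context (alpha beta : C) (a b : nat -> C) (A : C).

Definition extension_remainder (z : C) : C :=
  beta * conjc z + csum 0 (fun n => a n * unit_fold z ^+ n)
  + conjc (csum 1 (fun n => b n * unit_fold z ^+ n)) + A * logplus z.

Definition extension (z : C) : C := alpha * z + extension_remainder z.

(** In the closed disk [unit_fold z] is [conjc z], so conjugating the [b] series termwise produces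
    powers of [z], and the logarithmic term is 0. *)
Lemma extension_disk z : csummable 1 (fun n => b n * unit_fold z ^+ n) ->
  normc z <= 1 ->
  csummable 1 (fun n => conjc (b n) * z ^+ n) /\
  extension z = disk_map alpha beta a b z.
Proof.
move=> bz z1; have [sb cb] := csum_conj bz.
have E : (fun n => conjc (b n * unit_fold z ^+ n)) = (fun n => conjc (b n) * z ^+ n).
  by apply/funext => n; rewrite (fold_disk z1) (rmorphM conjc) (rmorphXn conjc)/= conjcK.
rewrite E in sb cb; split => //.
rewrite /extension /extension_remainder /disk_map -cb fold_disk//.
by rewrite /logplus (max_l z1) ln1 mulr0 addr0 !addrA.
Qed.

Lemma extension_outside f z : has_expansion f alpha beta a b A -> Delta z ->
  extension z = f z.
Proof.
move=> [_ fE] z1; have [_ _ ->] := fE z z1.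
rewrite /extension /extension_remainder /logplus max_r ?(ltW z1)//.
rewrite fold_outside ?(ltW z1)// !addrA.
congr (_ + csum 0 _ + conjc (csum 1 _) + _).
  by apply/funext => n; rewrite exprVn.
by apply/funext => n; rewrite exprVn.
Qed.

(** Splits the extended-real series into two real ones: nonnegative terms make the partial sums
    nondecreasing, and [K] bounds them. The [a] sum may start at 0 because that term has weight
    0. *)
Lemma weighted_coef_sums (K : R) :
  ((normc beta + normc A)%:E +
   \sum_(1 <= n <oo) (n%:R * (normc (a n) + normc (b n)))%:E <= K%:E)%E ->
  exists Ta Tb, [/\
    (fun n => \sum_(0 <= i < n) i%:R * normc (a i)) @ \oo --> Ta,
    (fun n => \sum_(1 <= i < n) i%:R * normc (b i)) @ \oo --> Tb
    & normc beta + normc A + (Ta + Tb) <= K].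
Proof.
move=> abK.
pose w (m : nat) (c : nat -> C) n := \sum_(m <= i < n) i%:R * normc (c i).
have w0 m c n : 0 <= w m c n.
  by rewrite sumr_ge0// => i _; rewrite mulr_ge0 ?normc_ge0.
have wnd m c : nondecreasing_seq (w m c).
  apply/nondecreasing_seqP => n; rewrite /w.
  have [mn|nm] := leqP m n.
    by rewrite big_nat_recr//= lerDl mulr_ge0 ?normc_ge0.
  by rewrite !big_geq// ltnW.
have w01 c n : w 0%N c n = w 1%N c n.
  by case: n => [|n]; [rewrite /w !big_geq|rewrite /w big_ltn// mul0r add0r].
have wK n : normc beta + normc A + (w 1%N a n + w 1%N b n) <= K.
  rewrite -lee_fin; apply: le_trans abK; rewrite EFinD leeD2l//.
  rewrite (_ : w 1%N a n + w 1%N b n =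
    \sum_(1 <= i < n) (i%:R * (normc (a i) + normc (b i)))); last first.
    by rewrite -big_split/=; apply: eq_bigr => i _; rewrite mulrDr.
  rewrite -sumEFin; apply: nneseries_lim_ge => i _ _.
  by rewrite lee_fin mulr_ge0// addr_ge0 ?normc_ge0.
have bound x y : 0 <= x -> normc beta + normc A + (x + y) <= K -> y <= K.
  by move=> x0; have := normc_ge0 beta; have := normc_ge0 A; lra.
have cvga : cvgn (w 0%N a).
  apply: nondecreasing_is_cvgn => //; exists K => _ [n _ <-].
  by rewrite w01; apply: (bound (w 1%N b n)) => //; rewrite [_ + w _ a _]addrC.
have cvgb : cvgn (w 1%N b).
  apply: nondecreasing_is_cvgn => //; exists K => _ [n _ <-].
  exact: bound (wK n).
exists (limn (w 0%N a)), (limn (w 1%N b)); split; [exact: cvga|exact: cvgb|].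
rewrite -lerBrDl -(limD cvga cvgb); apply: limr_le; first exact: (is_cvgD cvga cvgb).
by near=> n; have := wK n; rewrite -w01 -lerBrDl.
Unshelve. all: by end_near. Qed.

End Extension.

Theorem theorem4p1 (R : realType) (k : R) (f : R[i] -> R[i])
    (alpha beta : R[i]) (a b : nat -> R[i]) (A : R[i])
    (hk : 0 < k < 1) (hf : SigmaH_of k f alpha beta a b A) :
  exists f1 : R[i] -> R[i],
    [/\ forall z, Delta z -> f1 z = f z,
        homeomorphism_onto_image closed_Delta f1
      & exists F : R[i] -> R[i],
          [/\ forall z, closed_Delta z -> F z = f1 z,
              forall z, closed_disk z ->
                [/\ csummable 0 (fun n => a n * conjc z ^+ n),
                    csummable 1 (fun n => conjc (b n) * z ^+ n)
                  & F z = disk_map alpha beta a b z],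
              quasiconformal F
            & dilatation_bounded k F]].
Proof.
have [_ fE abK] := hf.
have a0 : alpha != 0.
  by rewrite -normc_gt0; case: fE => h _; exact: le_lt_trans (normc_ge0 _) h.
have [Ta [Tb [aT bT TK]]] := weighted_coef_sums abK.
have [asum aL adiff] := fold_series (isT : (0 <= 1)%N) aT.
have [bsum bL bdiff] := fold_series (isT : (1 <= 1)%N) bT.
pose h := extension_remainder beta a b A.
pose F := extension alpha beta a b A.
have hL : lipc (k * normc alpha) h.
  (* The constants of the four terms of [h]; their sum is at most [k |alpha|] by the coefficient
     condition. *)
  apply: (@lipc_le _ (normc beta * 1 + Ta + Tb + normc A * 1)); first by lra.
  apply: lipc_add; last exact: lipc_scale lipc_logplus.
  apply: lipc_add; last exact: lipc_conj bL.
  apply: lipc_add aL; exact: lipc_scale (lipc_conj (@lipc_id R)).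
have hdiff z : normc z != 1 -> exists p q, wirtinger h z p q.
  move=> z1; have [pa [qa wa]] := adiff z z1; have [pb [qb wb]] := bdiff z z1.
  have [pl [ql wl]] := wirtinger_logplus z1.
  have := wirtinger_add (wirtinger_add (wirtinger_add
    (wirtinger_scale beta (wirtinger_conj (wirtinger_id z))) wa)
    (wirtinger_conj wb)) (wirtinger_scale A wl).
  by move=> w; exact: (ex_intro _ _ (ex_intro _ _ w)).
have Fhomeo : plane_homeomorphism F by exact: (perturbation_homeomorphism a0 hk hL).
have Fdil : dilatation_bounded k F.
  (* The unit circle, where [h] may fail to be differentiable, is covered by the null set [N]. *)
  have [N [mN N0 offN]] := @ae_off_unit_circle R.
  exists N; split => //; apply: subset_trans offN; apply: subsetC => p p1.
  exact: (perturbation_dilatation a0 hk hL (hdiff _ p1)).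
have [k0 k1] := andP hk.
(* One plane map serves twice: restricted to the closed exterior it extends [f] to the circle, and
   as a whole it is the quasiconformal extension. *)
exists F; split.
- by move=> z; exact: (extension_outside fE).
- exact: (homeomorphism_restrict _ Fhomeo).
exists F; split; [by []| | |exact: Fdil].
- move=> z z1; have [sb FE] := extension_disk alpha beta a A (bsum z) z1.
  split; [|exact: sb|exact: FE].
  by have := asum z; rewrite fold_disk.
exists k; first by rewrite k1 ltW.
split; [exact: Fhomeo| | |exact: Fdil].
- exact: (perturbation_sense_preserving a0 k1 hL).
- exact: (lipc_ACL (lipc_add (lipc_scale alpha (@lipc_id R)) hL)).
Qed.
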